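(* Let $R=[a,b]\times[c,d]$, fix $\alpha\in\mathcal{C}(R)$ with $\|\alpha\|_\infty<1$ and $m,n\in\mathbb{N}$. The multi-valued mapping $\mathcal{V}^\alpha_{m,n}:\mathcal{C}(R)\rightrightarrows\mathcal{C}(R)$ defined by $$\mathcal{V}^\alpha_{m,n}(f)=\{f^\alpha_{\Delta,B_{m,n}}:\Delta\text{ ranges over all possible nets on }R\}$$ is lower semicontinuous (at every $f\in\mathcal{C}(R)$).
   Context: Here $a<b$, $c<d$, and $\mathcal{C}(R)$ is the Banach space of continuous real functions on $R$ with supremum norm $\|\cdot\|_\infty$. Bernstein operator: for $m,n\in\mathbb{N}$ and $f\in\mathcal{C}(R)$, $$B_{m,n}(f)(x,y)=\frac{1}{(b-a)^m(d-c)^n}\sum_{i=0}^m\sum_{j=0}^n f\Big(a+\tfrac{i(b-a)}{m},c+\tfrac{j(d-c)}{n}\Big)\binom{m}{i}\binom{n}{j}(x-a)^i(b-x)^{m-i}(y-c)^j(d-y)^{n-j}.$$ Net: $\Delta=\{(x_i,y_j):0\le i\le N,\ 0\le j\le M\}$ with $a=x_0<x_1<\dots<x_N=b$ and $c=y_0<y_1<\dots<y_M=d$, $N,M\ge2$ (here $N,M$ vary with the net). Put $I=[a,b]$, $J=[c,d]$, $I_i=[x_{i-1},x_i]$, $J_j=[y_{j-1},y_j]$, $R_{ij}=I_i\times J_j$. For $1\le i\le N$, $u_i:I\to I_i$ is a contraction that is a homeomorphism onto $I_i$, with $u_i(x_0)=x_{i-1}$, $u_i(x_N)=x_i$ if $i$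 is odd and $u_i(x_0)=x_i$, $u_i(x_N)=x_{i-1}$ if $i$ is even. For $1\le j\le M$, $v_j:J\to J_j$ is a contraction that is a homeomorphism onto $J_j$, with $v_j(y_0)=y_{j-1}$, $v_j(y_M)=y_j$ if $j$ is odd and $v_j(y_0)=y_j$, $v_j(y_M)=y_{j-1}$ if $j$ is even. For each net a choice of maps $u_i,v_j$ is fixed. Put $Q_{ij}(x,y)=(u_i^{-1}(x),v_j^{-1}(y))$ for $(x,y)\in R_{ij}$. $\alpha$-fractal function: for $f\in\mathcal{C}(R)$ and $\alpha\in\mathcal{C}(R)$ with $\|\alpha\|_\infty<1$, $f^\alpha_{\Delta,B_{m,n}}$ is the unique function in $\mathcal{C}(R)$ satisfying, for all $\boldsymbol{x}\in R_{ij}$, $1\le i\le N$, $1\le j\le M$, $$f^\alpha_{\Delta,B_{m,n}}(\boldsymbol{x})=f(\boldsymbol{x})+\alpha(\boldsymbol{x})f^\alpha_{\Delta,B_{m,n}}(Q_{ij}(\boldsymbol{x}))-\alpha(\boldsymbol{x})B_{m,n}(f)(Q_{ij}(\boldsymbol{x})).$$ It is known that this function exists and is unique and that $f\mapsto f^\alpha_{\Delta,B_{m,n}}$ is bounded and linear. A multi-valued mapping $T:X\rightrightarrows Y$ between normed spaces is lower semicontinuous at $x\in X$ if for every open $U\subseteq Y$ with $U\cap T(x)\ne\emptyset$ there is $\delta>0$ such that $U\cap T(x')\ne\emptyset$ whenever $\|x-x'\|_X<\delta$. *)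

(* Defs.v *)
From HB Require Import structures.
From mathcomp Require Import all_boot all_order all_algebra.
From mathcomp Require Import all_classical all_reals all_analysis.

Set Implicit Arguments.
Unset Strict Implicit.
Unset Printing Implicit Defensive.

Import Order.TTheory GRing.Theory Num.Theory numFieldNormedType.Exports.
Local Open Scope classical_set_scope.
Local Open Scope ring_scope.

Definition rect {R : realType} (a b c d : R) : set (R * R) :=
  `[a, b] `*` `[c, d].

Section ContinuousFunctions.
Context {R : realType} (a b c d : R).

(* A continuous real function on the rectangle is represented by its extension
   by zero to the whole plane, so that equality of representatives is equality
   on the rectangle. *)
Definition cont_rect : {pred R * R -> R} := fun f =>
  `[< {within rect a b c d, continuous f} /\
      forall p, ~ rect a b c d p -> f p = 0 >].

Record CRect := MkCRect { CRect_fun :> R * R -> R ; _ : CRect_fun \in cont_rect }.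

HB.instance Definition _ := [isSub for CRect_fun].
HB.instance Definition _ := [Choice of CRect by <:].

Lemma cont_rect_submod_closed : submod_closed cont_rect.
Proof.
split; first by apply/asboolP; split=> // p; exact: cvg_cst.
move=> k f g /asboolP[cf f0] /asboolP[cg g0]; apply/asboolP; split.
- move=> p; apply: (@cvgD _ _ _ _ _ _ _ (k * f p) (g p)); last exact: cg.
  by apply: cvgMl_tmp; exact: cf.
- by move=> p Np; rewrite !fctE f0// g0// scaler0 addr0.
Qed.

HB.instance Definition _ :=
  GRing.isSubmodClosed.Build _ _ cont_rect cont_rect_submod_closed.
HB.instance Definition _ := [SubChoice_isSubLmodule of CRect by <:].

Lemma CRect_continuous (f : CRect) : {within rect a b c d, continuous f}.
Proof. by have /asboolP[] := valP f. Qed.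

Lemma CRect_out (f : CRect) p : ~ rect a b c d p -> f p = 0.
Proof. by have /asboolP[_] := valP f; exact. Qed.

Lemma compact_rect : compact (rect a b c d).
Proof. by apply: compact_setX; exact: segment_compact. Qed.

Definition sup_norm (f : CRect) : R := sup [set `|f p| | p in rect a b c d].

Lemma sup_norm_has_ubound (f : CRect) :
  has_ubound [set `|f p| | p in rect a b c d].
Proof.
have := continuous_compact (@CRect_continuous f) compact_rect.
move=> /compact_bounded[M [_ MP]]; exists (M + 1) => _ [p pR <-].
by apply: (MP (M + 1)); [rewrite ltrDl|exists p].
Qed.

Lemma sup_norm_ub (f : CRect) p : `|f p| <= sup_norm f.
Proof.
have [pR|pR] := pselect (rect a b c d p).
  by apply: (ub_le_sup (sup_norm_has_ubound f)); exists p.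
rewrite CRect_out// normr0; have [[q qR]|R0] := pselect (rect a b c d !=set0).
  apply: (le_trans (normr_ge0 (f q))).
  by apply: (ub_le_sup (sup_norm_has_ubound f)); exists q.
suff -> : sup_norm f = 0 by [].
rewrite /sup_norm (_ : [set _ | _ in _] = set0) ?sup0//.
by rewrite -subset0; move=> x [q qR _]; apply: R0; exists q.
Qed.

Lemma sup_norm_le (f : CRect) M :
  0 <= M -> (forall p, rect a b c d p -> `|f p| <= M) -> sup_norm f <= M.
Proof.
move=> M0 fM; have [[q qR]|R0] := pselect (rect a b c d !=set0).
  by apply: ge_sup; [exists `|f q|, q|move=> _ [p pR <-]; exact: fM].
rewrite /sup_norm (_ : [set _ | _ in _] = set0) ?sup0//.
by rewrite -subset0; move=> x [q qR _]; apply: R0; exists q.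
Qed.

Lemma sup_norm_ge0 (f : CRect) : 0 <= sup_norm f.
Proof. by apply: le_trans (sup_norm_ub f 0). Qed.

Lemma ler_sup_normD (f g : CRect) : sup_norm (f + g) <= sup_norm f + sup_norm g.
Proof.
apply: sup_norm_le => [|p _]; first by rewrite addr_ge0 ?sup_norm_ge0.
by rewrite (le_trans (ler_normD (f p) (g p)))// lerD// sup_norm_ub.
Qed.

Lemma sup_norm_scale_le (k : R) (f : CRect) :
  sup_norm (k *: f) <= `|k| * sup_norm f.
Proof.
apply: sup_norm_le => [|p _]; first by rewrite mulr_ge0 ?sup_norm_ge0.
by rewrite (normrM k (f p)) ler_wpM2l// sup_norm_ub.
Qed.

Lemma sup_normZ (k : R) (f : CRect) : sup_norm (k *: f) = `|k| * sup_norm f.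
Proof.
apply/eqP; rewrite eq_le sup_norm_scale_le /=.
have [->|k0] := eqVneq k 0; first by rewrite normr0 mul0r sup_norm_ge0.
rewrite -ler_pdivlMl ?normr_gt0// -normfV.
by apply: le_trans (sup_norm_scale_le _ _); rewrite scalerA mulVf// scale1r.
Qed.

Lemma sup_norm0_eq0 (f : CRect) : sup_norm f = 0 -> f = 0.
Proof.
move=> f0; apply/val_inj/funext => p /=.
by apply/eqP; rewrite -normr_le0 -f0 sup_norm_ub.
Qed.

HB.instance Definition _ :=
  Lmodule_isNormed.Build R CRect ler_sup_normD sup_normZ sup_norm0_eq0.

End ContinuousFunctions.

Arguments CRect {R} a b c d.

Lemma CRect_normE (R : realType) (a b c d : R) (f : CRect a b c d) :
  `|f| = sup [set `|f p| | p in rect a b c d].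
Proof. by []. Qed.

Definition bernstein {R : realType} (a b c d : R) (m n : nat) (f : R * R -> R)
    (p : R * R) : R :=
  ((b - a) ^+ m * (d - c) ^+ n)^-1 *
  \sum_(i < m.+1) \sum_(j < n.+1)
    f (a + i%:R * (b - a) / m%:R, c + j%:R * (d - c) / n%:R) *
    'C(m, i)%:R * 'C(n, j)%:R *
    (p.1 - a) ^+ i * (b - p.1) ^+ (m - i) *
    (p.2 - c) ^+ j * (d - p.2) ^+ (n - j).

(* net_x lists x_1, ..., x_N and net_y lists y_1, ..., y_M; the initial nodes
   x_0 = a and y_0 = c are left implicit, as in itv_partition. *)
Record net {R : realType} (a b c d : R) := Net {
  net_x : seq R ;
  net_y : seq R ;
  net_xP : itv_partition a b net_x ;
  net_yP : itv_partition c d net_y ;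
  net_x_size : (2 <= size net_x)%N ;
  net_y_size : (2 <= size net_y)%N }.

Definition node {R : realType} (a : R) (s : seq R) (i : nat) : R :=
  nth a (a :: s) i.

Definition cell {R : realType} (a : R) (s : seq R) (i : nat) : set R :=
  `[node a s i.-1, node a s i].

Definition contraction_on {R : realType} (A : set R) (u : R -> R) : Prop :=
  exists2 k : R, 0 <= k < 1 & k.-lipschitz_A u.

Definition homeomorphism_onto {R : realType} (A B : set R) (u : R -> R) : Prop :=
  [/\ set_bij A B u, {within A, continuous u} &
      {within B, continuous (pinv A u)}].

Definition cell_maps {R : realType} (a b : R) (s : seq R) (u : nat -> R -> R) :
    Prop :=
  forall i : nat, (1 <= i <= size s)%N ->
    [/\ contraction_on `[a, b] (u i),
        homeomorphism_onto `[a, b] (cell a s i) (u i) &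
        if odd i then u i a = node a s i.-1 /\ u i b = node a s i
        else u i a = node a s i /\ u i b = node a s i.-1].

Record net_maps {R : realType} (a b c d : R) (D : net a b c d) := NetMaps {
  map_u : nat -> R -> R ;
  map_v : nat -> R -> R ;
  map_uP : cell_maps a b (net_x D) map_u ;
  map_vP : cell_maps c d (net_y D) map_v }.

Section FractalFunctions.
Context {R : realType} {a b c d : R}.
Implicit Types (D : net a b c d) (f g alpha : CRect a b c d).

Definition fractal_Q D (w : net_maps D) (i j : nat) (p : R * R) : R * R :=
  (pinv `[a, b] (map_u w i) p.1, pinv `[c, d] (map_v w j) p.2).

Definition fractal_eq alpha (m n : nat) D (w : net_maps D) f g : Prop :=
  forall i j : nat,
    (1 <= i <= size (net_x D))%N -> (1 <= j <= size (net_y D))%N ->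
  forall p, (cell a (net_x D) i `*` cell c (net_y D) j) p ->
    g p = f p + alpha p * g (fractal_Q w i j p)
        - alpha p * bernstein a b c d m n f (fractal_Q w i j p).

(* The solution of the self-referential equation exists and is unique when
   a < b, c < d and `|alpha| < 1, so that get is a definite description here. *)
Definition fractal_fun alpha (m n : nat) D (w : net_maps D) f : CRect a b c d :=
  get [set g | fractal_eq alpha m n w f g].

Definition fractal_multimap alpha (m n : nat) (w : forall D, net_maps D) f :
    set (CRect a b c d) :=
  [set fractal_fun alpha m n (w D) f | D in [set: net a b c d]].

End FractalFunctions.

Definition lower_semicontinuous_at {R : realType} {X Y : normedModType R}
    (T : X -> set Y) (x : X) : Prop :=
  forall U : set Y, open U -> U `&` T x !=set0 ->
  exists2 delta : R, 0 < delta &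
    forall x' : X, `|x - x'| < delta -> U `&` T x' !=set0.

(* Main.v *)
(* A net enters f^alpha only through a continuous map q of the rectangle into
   itself, glued from the inverse branches Q_ij, and the self-referential
   equation reads g = h + alpha * (g \o q) with h = f - alpha * (B f \o q).  As
   `|alpha| < 1 it is solved by fixed-point iteration.  Since the Bernstein
   operator has norm at most 1, subtracting the equations of f and f' gives
   `|f^alpha - f'^alpha| <= (1 + `|alpha|) / (1 - `|alpha|) * `|f - f'|,
   so f |-> f^alpha is continuous for each fixed net, and a union of continuous
   selections is lower semicontinuous. *)
Require Import Defs.
From mathcomp Require Import all_boot all_order all_algebra.
From mathcomp Require Import all_classical all_reals all_analysis.
From mathcomp Require Import ring.
Import Order.TTheory GRing.Theory Num.Theory numFieldNormedType.Exports.
Local Open Scope classical_set_scope.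
Local Open Scope ring_scope.

(** * Fixed-point iteration for the self-referential equation *)

Lemma continuous_geometric_limit {R : realType} {T : topologicalType}
    {F : nat -> T -> R} {G : T -> R} {r C : R} :
  `|r| < 1 -> (forall n, continuous (F n)) ->
  (forall n x, `|G x - F n x| <= C * r ^+ n) -> continuous G.
Proof.
move=> r1 cF FG x; apply/cvgrPdist_lt => e e0.
have e3 : 0 < e / 3 by rewrite divr_gt0.
have [n Cn] : exists n, C * r ^+ n < e / 3.
  have /cvgrPdist_lt/(_ _ e3)[n _ /(_ n (leqnn n))] := cvg_geometric C r1.
  by rewrite sub0r normrN => /(le_lt_trans (ler_norm _)); exists n.
have /cvgrPdist_lt/(_ _ e3) := cF n x; apply: filterS => y Fy.
have -> : G x - G y = (G x - F n x) + (F n x - F n y) + (F n y - G y) by ring.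
have -> : e = e / 3 + e / 3 + e / 3 by field.
rewrite (le_lt_trans (ler_normD _ _))// ltrD//; last first.
  by rewrite distrC (le_lt_trans (FG _ _)).
by rewrite (le_lt_trans (ler_normD _ _))// ltrD// (le_lt_trans (FG _ _)).
Qed.

(** The operator sending [g] to [H + A * (g \o q)] is an [r]-contraction for the supremum norm and
    preserves continuity, so its iterates from 0 converge uniformly, at geometric speed. All data
    live on a full space [T], which keeps subspace topologies out of the iteration. *)
Lemma self_referential_solution {R : realType} {T : topologicalType}
    {A H : T -> R} {q : T -> T} {r M : R} :
  0 <= r < 1 -> (forall x, `|A x| <= r) -> (forall x, `|H x| <= M) ->
  continuous A -> continuous H -> continuous q ->
  exists2 G : T -> R, continuous G & forall x, G x = H x + A x * G (q x).
Proof.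
move=> /andP[r0 r1] Ar HM cA cH cq.
pose F k := iter k (fun (g : T -> R) x => H x + A x * g (q x)) (fun=> 0).
have FS k x : F k.+1 x = H x + A x * F k (q x) by [].
have cF k : continuous (F k).
  elim: k => [|k IH] x; first exact: cvg_cst.
  apply: cvgD; first exact: cH.
  apply: cvgM; first exact: cA.
  by apply: continuous_comp; [exact: cq|exact: IH].
(* [C] solves [C = M + r * C], so the bound [C] is preserved by the iteration; as [F 0] is 0, it
   also starts the Cauchy estimate. *)
pose C := M / (1 - r).
have r1' : 0 < 1 - r by rewrite subr_gt0.
have FC k x : `|F k x| <= C.
  elim: k x => [|k IH] x.
    by rewrite normr0 divr_ge0 ?(ltW r1')// (le_trans (normr_ge0 (H x))).
  rewrite FS (le_trans (ler_normD _ _))//.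
  have -> : C = M + r * C by rewrite /C; field; rewrite gt_eqF.
  by rewrite lerD// normrM ler_pM.
have Fcauchy n k x : `|F (n + k)%N x - F n x| <= C * r ^+ n.
  elim: n x => [|n IH] x; first by rewrite subr0 expr0 mulr1.
  rewrite addSn !FS opprD addrACA subrr add0r -mulrBr normrM exprS mulrCA.
  exact: ler_pM.
have r1n : `|r| < 1 by rewrite ger0_norm.
have cvF x : cvgn (F^~ x).
  apply/cauchy_cvgP/cauchy_exP => e e0.
  have /cvgrPdist_lt/(_ _ e0)[n _ /(_ n (leqnn n))] := cvg_geometric C r1n.
  rewrite sub0r normrN => /(le_lt_trans (ler_norm _)) Cn.
  exists (F n x); exists n => // k /= nk; rewrite -ball_normE /= distrC.
  by rewrite -(subnKC nk) (le_lt_trans (Fcauchy _ _ _)).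
pose G x := limn (F^~ x).
have FG n x : `|G x - F n x| <= C * r ^+ n.
  have : (fun k => `|F k x - F n x|) @ \oo --> `|G x - F n x|.
    by apply: cvg_norm; apply: cvgB; [exact: cvF|exact: cvg_cst].
  move=> cv; rewrite -(cvg_lim _ cv)//; apply: limr_le; first exact: cvgP cv.
  by exists n => // k /= nk; rewrite -(subnKC nk).
exists G; first exact: continuous_geometric_limit r1n cF FG.
(* The recursion for [F k.+1] passes to the limit through the shifted sequence. *)
move=> x; apply: cvg_lim => //; rewrite -cvg_shiftS /=.
by apply: cvgD; [exact: cvg_cst|apply: cvgM; [exact: cvg_cst|exact: cvF]].
Qed.

(** * From continuity on the rectangle to continuity on the plane *)

Lemma continuous_within_comp {S T U : topologicalType} {A : set T}
    {f : T -> U} {g : S -> T} :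
  {within A, continuous f} -> continuous g -> (forall x, A (g x)) ->
  continuous (f \o g).
Proof.
move=> /subspace_continuousP cf cg Ag x; apply: cvg_comp (cf _ (Ag x)).
move=> B gB; have : nbhs x (g @^-1` [set y | A y -> B y]) := cg x _ gB.
by apply: filterS => y /= /(_ (Ag y)).
Qed.

Lemma continuous_pair {S T U : topologicalType} {f : S -> T} {g : S -> U} :
  continuous f -> continuous g -> continuous (fun x => (f x, g x)).
Proof. by move=> cf cg x; exact: (cvg_pair (cf x) (cg x)). Qed.

(** For [a <= b] this is the retraction of the line onto the segment; precomposing with it extends a
    function continuously, unlike extension by zero. *)
Definition clamp {R : realType} (a b x : R) : R := Num.max a (Num.min b x).

Lemma clamp_itv {R : realType} {a b : R} (x : R) :
  a <= b -> `[a, b]%classic (clamp a b x).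
Proof. by move=> ab; rewrite /= in_itv /= le_max lexx ge_max ab ge_min lexx. Qed.

Lemma clamp_id {R : realType} {a b x : R} : `[a, b]%classic x -> clamp a b x = x.
Proof.
by rewrite /= in_itv /= => /andP[ax xb]; rewrite /clamp min_r// max_r.
Qed.

Lemma clamp_continuous {R : realType} (a b : R) : continuous (clamp a b).
Proof.
move=> x; apply: (@continuous_max R R (cst a)); first exact: cvg_cst.
by apply: (@continuous_min R R (cst b)); [exact: cvg_cst|exact: cvg_id].
Qed.

(** * The Bernstein operator *)

Lemma bernstein_continuous {R : realType} (a b c d : R) m n (f : R * R -> R) :
  continuous (bernstein a b c d m n f).
Proof.
have cX (g : R * R -> R) k : continuous g -> continuous (fun p => g p ^+ k).
  move=> cg p; apply: (@continuous_comp _ _ _ g (fun x => x ^+ k)).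
    exact: cg.
  exact: exprn_continuous.
have c1 : continuous (fst : R * R -> R) by move=> p; exact: cvg_fst.
have c2 : continuous (snd : R * R -> R) by move=> p; exact: cvg_snd.
have cB (g h : R * R -> R) : continuous g -> continuous h ->
    continuous (fun p => g p - h p).
  by move=> cg ch p; apply: cvgB; [exact: cg|exact: ch].
have cc (k : R) : continuous (fun _ : R * R => k) by move=> p; exact: cvg_cst.
have cM (g h : R * R -> R) : continuous g -> continuous h ->
    continuous (fun p => g p * h p).
  by move=> cg ch p; apply: cvgM; [exact: cg|exact: ch].
apply: (cM _ _) => //; apply: continuous_big => [|i _]; first exact: add_continuous.
apply: continuous_big => [|j _]; first exact: add_continuous.
by do !apply: (cM _ _) => //; apply: (cX _ _); exact: (cB _ _).
Qed.

Lemma bernsteinB {R : realType} (a b c d : R) m n (f g : R * R -> R) p :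
  bernstein a b c d m n f p - bernstein a b c d m n g p =
  bernstein a b c d m n (fun x => f x - g x) p.
Proof.
rewrite /bernstein -mulrBr -sumrB; congr (_ * _); apply: eq_bigr => i _.
by rewrite -sumrB; apply: eq_bigr => j _; rewrite -!mulrBl.
Qed.

(** On the rectangle the Bernstein weights are nonnegative and sum to 1, so the value is an average
    of samples of [f]. The bound over the whole plane is one that zero extensions satisfy. *)
Lemma bernstein_le {R : realType} {a b c d : R} m n {f : R * R -> R} {p} {M} :
  a < b -> c < d -> (forall x, `|f x| <= M) -> rect a b c d p ->
  `|bernstein a b c d m n f p| <= M.
Proof.
move=> ab cd fM [/=]; rewrite !in_itv /= => /andP[ap pb] /andP[cp pd].
have W (s t x : R) k : (t - s) ^+ k =
    \sum_(i < k.+1) 'C(k, i)%:R * (x - s) ^+ i * (t - x) ^+ (k - i).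
  have -> : t - s = (t - x) + (x - s) by ring.
  rewrite exprDn; apply: eq_bigr => i _.
  by rewrite -mulr_natl mulrA mulrAC.
have D0 : 0 < (b - a) ^+ m * (d - c) ^+ n.
  by rewrite mulr_gt0// exprn_gt0// subr_gt0.
rewrite normrM gtr0_norm ?invr_gt0// ler_pdivrMl//.
(* The normalising factor, now on the right, expands by the binomial theorem into the sum of the
   weights; the comparison is then termwise. *)
rewrite (W a b p.1) (W c d p.2) big_distrlr /= mulr_suml.
rewrite (le_trans (ler_norm_sum _ _ _))//; apply: ler_sum => i _.
rewrite mulr_suml (le_trans (ler_norm_sum _ _ _))//; apply: ler_sum => j _.
set u := (X in `|X|).
have -> : u = f (a + i%:R * (b - a) / m%:R, c + j%:R * (d - c) / n%:R) *
  ('C(m, i)%:R * (p.1 - a) ^+ i * (b - p.1) ^+ (m - i) *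
  ('C(n, j)%:R * (p.2 - c) ^+ j * (d - p.2) ^+ (n - j))) by rewrite /u; ring.
rewrite normrM mulrC; set v := (X in `|X| * _).
have v0 : 0 <= v by rewrite /v !mulr_ge0// exprn_ge0// subr_ge0.
by rewrite (ger0_norm v0) ler_wpM2l.
Qed.

(** * Nodes and cells of a net *)

Lemma node_size {R : realType} {a b : R} {s : seq R} :
  itv_partition a b s -> node a s (size s) = b.
Proof. by move=> [_ /eqP sb]; rewrite /node -(last_nth a). Qed.

Lemma node_le {R : realType} {a b : R} {s : seq R} {i j : nat} :
  itv_partition a b s -> (i <= j <= size s)%N -> node a s i <= node a s j.
Proof.
move=> [ps _] /andP[ij js]; apply: (sorted_leq_nth le_trans lexx a) => //=.
- by apply: sub_path ps => x y /ltW.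
- by rewrite inE /= ltnS (leq_trans ij).
Qed.

Lemma cell_cover {R : realType} {a b : R} {s : seq R} {x : R} :
  itv_partition a b s -> (0 < size s)%N -> `[a, b]%classic x ->
  exists2 i, (1 <= i <= size s)%N & cell a s i x.
Proof.
move=> abs s0; rewrite /= in_itv /= -{1}(node_size abs) => /andP[ax].
have : (size s <= size s)%N by [].
(* Induction on an index [k] with [0 < k <= size s] and [x <= node a s k]; the cell is still sought
   in the whole list. *)
elim: {1 2 4}(size s) s0 => [//|[_ _ s1 xn|k IH _ ks xk]].
  by exists 1%N; rewrite ?s1// /cell /= in_itv /= ax.
have [xk'|/ltW kx] := leP x (node a s k.+1); first exact: IH (ltnW ks) xk'.
by exists k.+2; rewrite ?ks// /cell /= in_itv /= kx.
Qed.

Lemma cell_sub {R : realType} {a b : R} {s : seq R} {i : nat} :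
  itv_partition a b s -> (1 <= i <= size s)%N -> cell a s i `<=` `[a, b].
Proof.
move=> abs /andP[i1 iN] x; rewrite /cell /= !in_itv /= => /andP[ix xi].
apply/andP; split.
  apply: le_trans ix; apply: (node_le (i := 0%N) abs).
  by rewrite (leq_trans (leq_pred i)).
by rewrite -(node_size abs) (le_trans xi)// (node_le abs)// iN leqnn.
Qed.

(** * Gluing the inverse branches *)

Lemma cell_maps_pinv {R : realType} {a b : R} {s : seq R} {u : nat -> R -> R}
    {i : nat} {x : R} :
  cell_maps a b s u -> (1 <= i <= size s)%N -> cell a s i x ->
  `[a, b]%classic (pinv `[a, b] (u i) x).
Proof.
move=> us iN xi; have [_ [bij_u _ _] _] := us i iN.
by have [pinv_fun _ _] := bijpinv_bij (fun=> point) bij_u; exact: pinv_fun.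
Qed.

(* The alternating orientation gives u_k and u_(k+1) the same preimage of the
   common node, so the inverse branches glue to a continuous map. *)
Lemma cell_maps_glue {R : realType} {a b : R} {s : seq R} {u : nat -> R -> R} :
  a < b -> itv_partition a b s -> (0 < size s)%N -> cell_maps a b s u ->
  exists q : R -> R, [/\ {within `[a, b], continuous q},
    forall x, `[a, b]%classic x -> `[a, b]%classic (q x) &
    forall i x, (1 <= i <= size s)%N -> cell a s i x ->
      q x = pinv `[a, b] (u i) x].
Proof.
move=> ab abs s0 us.
have aab : a \in `[a, b]%classic by rewrite inE /= in_itv /= lexx ltW.
have bab : b \in `[a, b]%classic by rewrite inE /= in_itv /= lexx ltW.
(* The common preimage is [b] for odd [k] and [a] for even [k]. *)
have pinv_node k : (1 <= k)%N -> (k < size s)%N ->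
    pinv `[a, b] (u k) (node a s k) = pinv `[a, b] (u k.+1) (node a s k).
  move=> k1 ks.
  have [_ [[_ inj _] _ _]] := us k ltac:(by rewrite k1 ltnW).
  have [_ [[_ injS _] _ _]] := us k.+1 ltac:(by rewrite ks).
  move=> /=; case: (boolP (odd k)) => /= ok [uSa uSb] [uka ukb].
    by rewrite -{1}ukb -uSb !(pinvKV (fun=> point)).
  by rewrite -{1}uka -uSa !(pinvKV (fun=> point)).
have glue k : (0 < k)%N -> (k <= size s)%N ->
    exists2 q : R -> R, {within `[a, node a s k], continuous q} &
    forall i x, (1 <= i <= k)%N -> cell a s i x -> q x = pinv `[a, b] (u i) x.
  elim: k => [//|[_ _ s1|k IH _ ks]].
    exists (pinv `[a, b] (u 1%N)) => [|i x].
      by have [_ [_ _]] := us 1%N ltac:(by rewrite s1).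
    by rewrite -eqn_leq => /eqP <-.
  have [q cq qE] := IH isT (ltnW ks).
  (* At the node shared with the new cell [q'] keeps the old value; [pinv_node] makes it agree with
     the new branch. *)
  pose q' x := if x <= node a s k.+1 then q x else pinv `[a, b] (u k.+2) x.
  have q'E i x : (1 <= i <= k.+2)%N -> cell a s i x ->
      q' x = pinv `[a, b] (u i) x.
    move=> /andP[i1]; rewrite leq_eqVlt => /predU1P[->|].
      rewrite /q' /cell /= in_itv /= => /andP[kx _]; case: ifP => // xk.
      have -> : x = node a s k.+1 by apply/eqP; rewrite eq_le xk.
      rewrite -pinv_node//; apply: qE; first by rewrite !leqnn.
      by rewrite /cell /= in_itv /= lexx andbT (node_le abs)// leqnSn ltnW.
    rewrite ltnS => ik xi; rewrite /q' ifT; first by apply: qE; rewrite ?i1.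
    move: xi; rewrite /cell /= in_itv /= => /andP[_ /le_trans]; apply.
    by rewrite (node_le abs)// ik ltnW.
  exists q' => //.
  have ak : a <= node a s k.+1 by apply: (node_le (i := 0%N) abs); exact: ltnW.
  have kk : node a s k.+1 <= node a s k.+2.
    by apply: (node_le abs); rewrite leqnSn.
  have -> : `[a, node a s k.+2]%classic = `[a, node a s k.+1] `|` cell a s k.+2.
    apply/seteqP; split => x; rewrite /cell /= !in_itv /=.
      by move=> /andP[-> ->]; rewrite andbT; apply/orP; rewrite le_total.
    move=> [/andP[-> /le_trans]->//|/andP[kx ->]].
    by rewrite (le_trans ak kx).
  (* Pasting along two closed sets. *)
  apply: withinU_continuous; [exact: itv_closed|exact: itv_closed| |].
    apply: subspace_eq_continuous cq => x.
    by rewrite inE /= in_itv /= => /andP[_ xk]; rewrite /from_subspace /q' xk.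
  have [_ [_ _ cu] _] := us k.+2 ltac:(by rewrite ks).
  apply: subspace_eq_continuous cu => x /set_mem xk.
  by apply/esym/q'E; rewrite ?leqnn.
have [q cq qE] := glue _ s0 (leqnn _).
exists q; split => //; first by rewrite (node_size abs) in cq.
move=> x /(cell_cover abs s0)[i iN xi]; rewrite (qE i)//.
exact: cell_maps_pinv us iN xi.
Qed.

(** * Existence and stability of the fractal function *)

Lemma CRect_normr_le {R : realType} {a b c d : R} (f : CRect a b c d) p :
  `|f p| <= `|f|.
Proof. exact: sup_norm_ub. Qed.

Lemma CRectB {R : realType} {a b c d : R} (f g : CRect a b c d) p :
  (f - g) p = f p - g p.
Proof. by []. Qed.

(** The equation is moved to the plane by precomposing with [cl], solved there, and its solution cut
    back to the rectangle. *)
Lemma fractal_eq_solvable {R : realType} {a b c d : R} {alpha : CRect a b c d}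
    (m n : nat) {D : net a b c d} (w : net_maps D) (f : CRect a b c d) :
  a < b -> c < d -> `|alpha| < 1 -> exists g, fractal_eq alpha m n w f g.
Proof.
move=> ab cd alpha1.
have [qx [cqx qxI qxE]] := cell_maps_glue ab (net_xP D)
  (ltnW (net_x_size D)) (map_uP w).
have [qy [cqy qyI qyE]] := cell_maps_glue cd (net_yP D)
  (ltnW (net_y_size D)) (map_vP w).
pose cl (p : R * R) := (clamp a b p.1, clamp c d p.2).
have cl_rect p : rect a b c d (cl p) by split; apply/clamp_itv/ltW.
have cl_id p : rect a b c d p -> cl p = p.
  by case: p => x y [/= px py]; rewrite /cl /= !clamp_id.
have c1 : continuous (fst : R * R -> R) by move=> p; exact: cvg_fst.
have c2 : continuous (snd : R * R -> R) by move=> p; exact: cvg_snd.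
have ccl : continuous cl.
  apply: continuous_pair => p.
    apply: (@continuous_comp _ _ _ fst (clamp a b)); first exact: c1.
    exact: clamp_continuous.
  apply: (@continuous_comp _ _ _ snd (clamp c d)); first exact: c2.
  exact: clamp_continuous.
(* [q] maps the plane into the rectangle and agrees with [fractal_Q] on each cell. *)
pose q p := (qx (cl p).1, qy (cl p).2).
have q_rect p : rect a b c d (q p).
  by have [px py] := cl_rect p; split; [exact: qxI|exact: qyI].
have cq : continuous q.
  have cx : continuous (qx \o (fst \o cl)).
    apply: (continuous_within_comp cqx) => p; last exact: (cl_rect p).1.
    by apply: (@continuous_comp _ _ _ cl fst); [exact: ccl|exact: c1].
  have cy : continuous (qy \o (snd \o cl)).
    apply: (continuous_within_comp cqy) => p; last exact: (cl_rect p).2.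
    by apply: (@continuous_comp _ _ _ cl snd); [exact: ccl|exact: c2].
  exact: continuous_pair cx cy.
pose H p := f (cl p) - alpha (cl p) * bernstein a b c d m n f (q p).
have cext (h : CRect a b c d) : continuous (h \o cl).
  exact: continuous_within_comp (CRect_continuous (f := h)) ccl cl_rect.
have HM p : `|H p| <= `|f| + `|alpha| * `|f|.
  rewrite (le_trans (ler_normB _ _))// lerD ?CRect_normr_le// normrM.
  rewrite ler_pM// ?CRect_normr_le//.
  by apply: bernstein_le => // x; exact: CRect_normr_le.
have cH : continuous H.
  move=> p; apply: cvgB; first exact: (cext f p).
  apply: cvgM; first exact: (cext alpha p).
  by apply: (@continuous_comp _ _ _ q); [exact: cq|exact: bernstein_continuous].
have alpha01 : 0 <= `|alpha| < 1 by rewrite normr_ge0.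
have [G cG GE] := self_referential_solution alpha01
  (fun p => CRect_normr_le alpha (cl p)) HM (cext alpha) cH cq.
(* Setting 0 outside gives the representative that [CRect] requires; the equation evaluates [g] only
   at [p] and [q p], both in the rectangle. *)
pose g p := if p \in rect a b c d then G p else 0.
have gE p : rect a b c d p -> g p = G p by move=> pR; rewrite /g mem_set.
have g_cont : g \in cont_rect a b c d.
  apply/asboolP; split=> [|p Np]; last by rewrite /g memNset.
  apply: (@subspace_eq_continuous _ _ _ G); last exact: continuous_subspaceT.
  by move=> p /set_mem /gE.
exists (MkCRect g_cont) => i j iN jM p [pi pj] /=.
have pR : rect a b c d p.
  split; first exact: cell_sub (net_xP D) iN _ pi.
  exact: cell_sub (net_yP D) jM _ pj.
have qE : fractal_Q w i j p = q p.
  by rewrite /q cl_id// (qxE i)// (qyE j).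
rewrite !gE//; last by rewrite qE.
rewrite GE /H /= qE cl_id//; ring.
Qed.

Lemma fractal_eq_lipschitz {R : realType} {a b c d : R} {alpha : CRect a b c d}
    {m n : nat} {D : net a b c d} {w : net_maps D} {f f' g g' : CRect a b c d} :
  a < b -> c < d -> `|alpha| < 1 ->
  fractal_eq alpha m n w f g -> fractal_eq alpha m n w f' g' ->
  `|g - g'| <= (1 + `|alpha|) / (1 - `|alpha|) * `|f - f'|.
Proof.
move=> ab cd alpha1 fg fg'.
have alpha1' : 0 < 1 - `|alpha| by rewrite subr_gt0.
(* As [|alpha| < 1], the term [|alpha| * |g - g'|] can be absorbed on the left. *)
suff : `|g - g'| <= `|f - f'| + `|alpha| * (`|g - g'| + `|f - f'|).
  move=> le_gg'; rewrite mulrAC ler_pdivlMr// mulrBr mulr1 lerBlDr.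
  by rewrite (le_trans le_gg')// le_eqVlt; apply/orP; left; apply/eqP; ring.
apply: sup_norm_le => [|p [px py]].
  by rewrite !(addr_ge0, mulr_ge0).
have [i iN pi] := cell_cover (net_xP D) (ltnW (net_x_size D)) px.
have [j jM pj] := cell_cover (net_yP D) (ltnW (net_y_size D)) py.
rewrite CRectB (fg i j)// (fg' i j)//; set Q := fractal_Q w i j p.
have QR : rect a b c d Q.
  split; first exact: cell_maps_pinv (map_uP w) iN pi.
  exact: cell_maps_pinv (map_vP w) jM pj.
set B := bernstein a b c d m n.
(* Both equations use the same point [Q], so linearity of [B] leaves only differences. *)
have -> : f p + alpha p * g Q - alpha p * B f Q -
    (f' p + alpha p * g' Q - alpha p * B f' Q) =
    (f - f') p + alpha p * ((g - g') Q - B (f - f') Q).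
  by rewrite !CRectB -[B (f - f') Q]bernsteinB -/B; ring.
rewrite (le_trans (ler_normD _ _))// lerD ?CRect_normr_le// normrM.
rewrite ler_pM ?CRect_normr_le// (le_trans (ler_normB _ _))//.
rewrite lerD ?CRect_normr_le//.
by apply: bernstein_le => // x; exact: CRect_normr_le.
Qed.

Theorem theorem3p12 (R : realType) (a b c d : R) (hab : a < b) (hcd : c < d)
    (w : forall D : net a b c d, net_maps D)
    (alpha : CRect a b c d) (halpha : `|alpha| < 1)
    (m n : nat) (hm : (0 < m)%N) (hn : (0 < n)%N) (f : CRect a b c d) :
  lower_semicontinuous_at (fractal_multimap alpha m n w) f.
Proof.
move=> U oU [g [Ug [D _ gE]]]; rewrite -{}gE in Ug.
(* Solvability makes the value chosen by [get] a genuine solution. *)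
have fracP h : fractal_eq alpha m n (w D) h (fractal_fun alpha m n (w D) h).
  exact: (getPex (P := [set g | fractal_eq alpha m n (w D) h g])
    (fractal_eq_solvable m n (w D) h hab hcd halpha)).
have /nbhs_ballP[e /= e0 eU] := open_nbhs_nbhs (conj oU Ug).
pose K := (1 + `|alpha|) / (1 - `|alpha|).
have K0 : 0 < K by rewrite divr_gt0 ?subr_gt0// ltr_wpDr.
(* [K] is the Lipschitz constant of the selection for [D]; keeping the net [D] for [f'] puts its
   fractal function within [e] of that of [f]. *)
exists (e / K) => [|f' ff']; first exact: divr_gt0.
exists (fractal_fun alpha m n (w D) f'); split; last by exists D.
apply: eU; rewrite -ball_normE /=.
apply: le_lt_trans (fractal_eq_lipschitz hab hcd halpha (fracP f) (fracP f')) _.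
by rewrite mulrC -ltr_pdivlMr.
Qed.
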